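(* Let $G=(V,E)$ be a finite simple graph and let $e=\{u,v\}\in E$. If $e$ is an irrelevant edge of $G$, i.e. $D_t(G,x)=D_t(G\setminus e,x)$, then both $u$ and $v$ are total domination-covered in the graph $G\setminus e$.
   Context: For a finite simple graph $G=(V,E)$, a set $D\subseteq V$ is a total dominating set if every vertex of $V$ is adjacent to some vertex of $D$. $d_t(G,i)$ is the number of total dominating sets of $G$ of cardinality $i$, and $D_t(G,x)=\sum_i d_t(G,i)x^i$ is the total domination polynomial (equal to $0$ if $G$ has an isolated vertex). $G\setminus e$ denotes $G$ with the edge $e$ deleted (vertices kept); $G\setminus v$ denotes $G$ with the vertex $v$ deleted. An edge $e$ of $G$ is irrelevant if $D_t(G,x)=D_t(G\setminus e,x)$. A vertex $v$ of a graph $G$ is total domination-covered (in $G$) if each total dominating set of $G\setminus v$ is a total dominating set of $G$ and the total dominating sets of $G\setminus v$ are exactly those total dominating sets of $G$ that do not include $v$. *)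

(* Defs.v *)
From HB Require Import structures.
From mathcomp Require Import all_boot all_order all_algebra.

Set Implicit Arguments.
Unset Strict Implicit.
Unset Printing Implicit Defensive.

Import GRing.Theory.

Record sgraph := SGraph {
  vertex :> finType;
  adj : rel vertex;
  adj_sym : symmetric adj;
  adj_irrefl : irreflexive adj
}.

Definition edges (G : sgraph) : {set {set G}} :=
  [set e : {set G} | [exists x, exists y, adj x y && (e == [set x; y])]].

Section Deletions.
Variable G : sgraph.

Definition del_edge_adj (e : {set G}) : rel G :=
  fun x y => adj x y && ([set x; y] != e).

Lemma del_edge_sym (e : {set G}) : symmetric (del_edge_adj e).
Proof. by move=> x y; rewrite /del_edge_adj adj_sym setUC. Qed.

Lemma del_edge_irrefl (e : {set G}) : irreflexive (del_edge_adj e).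
Proof. by move=> x; rewrite /del_edge_adj adj_irrefl. Qed.

Definition del_edge (e : {set G}) : sgraph :=
  SGraph (del_edge_sym e) (del_edge_irrefl e).

Definition del_vertex_adj (v : G) : rel {x : G | x != v} :=
  fun x y => adj (val x) (val y).

Lemma del_vertex_sym (v : G) : symmetric (@del_vertex_adj v).
Proof. by move=> x y; apply: adj_sym. Qed.

Lemma del_vertex_irrefl (v : G) : irreflexive (@del_vertex_adj v).
Proof. by move=> x; apply: adj_irrefl. Qed.

Definition del_vertex (v : G) : sgraph :=
  SGraph (@del_vertex_sym v) (@del_vertex_irrefl v).

End Deletions.

Definition total_dominating (G : sgraph) (D : {set G}) : bool :=
  [forall x : G, exists y in D, adj x y].

Definition num_tds (G : sgraph) (i : nat) : nat :=
  #|[set D : {set G} | total_dominating D & #|D| == i]|.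

Definition tdpoly (G : sgraph) : {poly int} :=
  (\sum_(i < #|G|.+1) (num_tds G i)%:R *: 'X^i)%R.

Lemma tdpoly_isolated (G : sgraph) (x : G) :
  (forall y, ~~ adj x y) -> tdpoly G = 0%R.
Proof.
move=> isox; rewrite /tdpoly big1 // => i _.
rewrite /num_tds (_ : [set D | _ & _] = set0) ?cards0 ?scale0r //.
apply/setP=> D; rewrite !inE; apply/negP=> /andP[/forallP/(_ x)].
by case/exists_inP=> y _; rewrite (negPf (isox y)).
Qed.

Definition irrelevant_edge (G : sgraph) (e : {set G}) : Prop :=
  tdpoly G = tdpoly (del_edge e).

(* Sets of vertices of G \ v live in a subtype of G; [lift_set] views them as
   sets of vertices of G. *)
Definition lift_set (G : sgraph) (v : G) (S : {set del_vertex v}) : {set G} :=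
  [set val x | x in S].

Definition total_dom_covered (G : sgraph) (v : G) : Prop :=
  (forall S : {set del_vertex v},
     total_dominating S -> total_dominating (lift_set S)) /\
  [set lift_set S | S : {set del_vertex v} & total_dominating S] =
  [set D : {set G} | total_dominating D & v \notin D].

(* Main.v *)
(** Deleting [e] can only destroy total dominating sets, so if [D_t] is
    unchanged, [G] and [G \ e] have the same total dominating sets.  If [S] is
    total dominating in [(G \ e) \ u], then [S] together with [v] is total
    dominating in [G], hence in [G \ e]; there [u] has a neighbour in it, which
    is not [v] because [e] is deleted, so it lies in [S]. *)
Require Import Defs.
From HB Require Import structures.
From mathcomp Require Import all_boot all_order all_algebra.

Import GRing.Theory Num.Theory.

Lemma total_dominatingP (G : sgraph) (D : {set G}) :
  reflect (forall x, exists2 y, y \in D & adj x y) (total_dominating D).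
Proof. by apply: (iffP forallP) => H x; apply/exists_inP/H. Qed.

Lemma num_tds_coef (G : sgraph) (i : nat) :
  i <= #|G| -> ((tdpoly G)`_i)%R = ((num_tds G i)%:R)%R.
Proof.
move=> le_i; rewrite /tdpoly -(@poly_def _ _ (fun i => (num_tds G i)%:R)%R).
by rewrite coef_poly ltnS le_i.
Qed.

Lemma tdpoly_num_tds (G H : sgraph) (i : nat) :
  i <= #|G| -> i <= #|H| -> tdpoly G = tdpoly H -> num_tds G i = num_tds H i.
Proof.
move=> leG leH eqGH; have := num_tds_coef G i leG.
(* The coefficients are integers, and naturals embed injectively there. *)
by rewrite eqGH num_tds_coef // => /eqP; rewrite eqr_nat => /eqP.
Qed.

Lemma total_dominating_del_edge (G : sgraph) (e D : {set G}) :
  @total_dominating (del_edge e) D -> total_dominating D.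
Proof.
move=> /total_dominatingP tD; apply/total_dominatingP => x.
by have [y yD /andP[xy _]] := tD x; exists y.
Qed.

(** Within each cardinality, the total dominating sets of [del_edge e] are among those of [G]; equal
    coefficients make these finite families equinumerous, hence equal. *)
Lemma irrelevant_edge_total_dominating (G : sgraph) (e D : {set G}) :
  irrelevant_edge e ->
  @total_dominating (del_edge e) D = total_dominating D.
Proof.
move=> irr; apply/idP/idP; first exact: total_dominating_del_edge.
move=> tD; have leD : #|D| <= #|G| := max_card D.
have eq_num := tdpoly_num_tds G (del_edge e) _ leD leD irr.
set tds := [set A : {set G} | total_dominating A & #|A| == #|D|].
set tds_e :=
  [set A : {set G} | @total_dominating (del_edge e) A & #|A| == #|D|].
have sub : tds_e \subset tds.
  apply/subsetP=> A; rewrite !inE => /andP[tA ->].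
  by rewrite (total_dominating_del_edge _ _ _ tA).
have /eqP eq_tds : tds_e == tds by rewrite eqEcard sub -/(num_tds G _) eq_num /=.
have : D \in tds by rewrite inE tD eqxx.
by rewrite -eq_tds inE => /andP[].
Qed.

Lemma total_dominating_lift_set_edge (G : sgraph) (u v : G)
    (S : {set @del_vertex (del_edge [set u; v]) u}) :
  adj u v -> irrelevant_edge [set u; v] -> total_dominating S ->
  total_dominating (lift_set S).
Proof.
move=> uv irr /total_dominatingP tS.
have dom x : x != u -> exists2 y, y \in lift_set S &
    @adj (del_edge [set u; v]) x y.
  move=> xu; have [y yS xy] := tS (Sub x xu).
  by exists (val y); first exact: imset_f.
have tSv : @total_dominating G (v |: lift_set S).
  (* In [G] the edge [e] is present, so [v] dominates [u]; [S] takes care of the other vertices. *)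
  apply/total_dominatingP=> x; have [->|xu] := eqVneq x u.
    by exists v; rewrite ?setU11.
  by have [y yS /andP[xy _]] := dom x xu; exists y; rewrite ?setU1r.
apply/total_dominatingP=> x; have [->|] := eqVneq x u; last exact: dom.
move: tSv; rewrite -(irrelevant_edge_total_dominating _ _ _ irr).
move/total_dominatingP/(_ u) => [y /setU1P[->|yS] uy]; last by exists y.
by move: uy => /andP[_]; rewrite eqxx.
Qed.

(** The equality of families follows from the lifting condition: a total dominating set avoiding [v]
    gives each vertex a neighbour other than [v], which survives in [del_vertex v]. *)
Lemma total_dom_coveredP (G : sgraph) (v : G) :
  (forall S : {set del_vertex v},
     total_dominating S -> total_dominating (lift_set S)) ->
  total_dom_covered v.
Proof.
move=> tL; split=> //; apply/setP=> D; rewrite inE; apply/imsetP/andP.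
  case=> S; rewrite inE => tS ->; split; first exact: tL.
  by apply/negP=> /imsetP[x _ vx]; have := valP x; rewrite -vx eqxx.
case=> /total_dominatingP tD vD.
have neq_v y : y \in D -> y != v by apply: contraTneq => ->.
exists ([set x | val x \in D] : {set del_vertex v}).
  rewrite inE; apply/total_dominatingP => x.
  have [y yD xy] := tD (val x).
  by exists (Sub y (neq_v y yD)); rewrite ?inE.
apply/setP=> y; apply/idP/imsetP => [yD|[x]]; last by rewrite inE => xD ->.
by exists (Sub y (neq_v y yD)); rewrite ?inE.
Qed.

Lemma edges_adj (G : sgraph) (u v : G) : [set u; v] \in edges G -> adj u v.
Proof.
rewrite inE => /existsP[x /existsP[y /andP[xy /eqP uvE]]].
have xNy : x != y by apply: contraTneq xy => ->; rewrite adj_irrefl.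
have uNv : u != v.
  (* The pair has two elements because [x] and [y] differ, so [u] and [v] cannot coincide. *)
  by have := cards2 u v; rewrite uvE cards2 xNy; case: (u != v).
have: u \in [set x; y] by rewrite -uvE set21.
have: v \in [set x; y] by rewrite -uvE set22.
(* The pair is unordered: [u], [v] may be [x], [y] in either order, and the two remaining cases
   contradict [uNv]. *)
move=> /set2P[] vE /set2P[] uE; rewrite uE vE ?xy // 1?adj_sym //.
all: by rewrite uE vE eqxx in uNv.
Qed.

Theorem theorem2p3 (G : sgraph) (u v : G) (e : {set G})
    (euv : e = [set u; v]) (eE : e \in edges G) (irr : irrelevant_edge e) :
  @total_dom_covered (del_edge e) u /\ @total_dom_covered (del_edge e) v.
Proof.
(* Stated for any naming of the endpoints, so that swapping them yields the claim for [v]. *)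
have covered x y : e = [set x; y] -> @total_dom_covered (del_edge e) x.
  move=> exy; rewrite exy in eE irr *; apply: total_dom_coveredP => S.
  exact: total_dominating_lift_set_edge (edges_adj _ _ _ eE) irr.
by split; [apply: covered euv | apply: (covered v u); rewrite setUC].
Qed.
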